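(* Let $A=(A_0,A_1,A_2,A_3)$ be a 3-restricted complete semi-Segal type. Then $A$ admits a 2-degeneracy structure.
   Context: Work in homotopy type theory with a univalent universe $\mathcal U$. Semi-Segal types. A 3-restricted semisimplicial type is a tuple $(A_0,A_1,A_2,A_3)$ with $A_0:\mathcal U$ and, for $1\le k\le 3$, $A_k:\partial\mathbf\Delta^k\to\mathcal U$. Here $\partial\mathbf\Delta^k$ is the iterated $\Sigma$-type with one component $x_S$ for every nonempty proper subset $S\subsetneq\{0,\dots,k\}$, where $x_S:A_{|S|-1}\big((x_T)_{\emptyset\ne T\subsetneq S}\big)$ (reindexed along the order-preserving bijection $S\cong\{0,\dots,|S|-1\}$), and $x_i:A_0$ for singletons. For $k\in\{2,3\}$ and $0\le m\le k$, $\Lambda^k_m$ is the $\Sigma$-type with the same components as $\partial\mathbf\Delta^k$ except that $x_{\{0,\dots,k\}\setminus\{m\}}$ is removed. The type of fillers of $u:\Lambda^k_m$ is the type of pairs $(x_{\{0,\dots,k\}\setminus\{m\}},x_{\{0,\dots,k\}})$ of elements of the appropriate $A_{k-1}(\ldots)$ and $A_k(\ldots)$; $u$ has contractible filling if this type is contractible. A 3-restricted semi-Segal type is a 3-restricted semisimplicial type where all $\Lambda^2_1$- and $\Lambda^3_1$-horns have contractible filling. An edge $e:A_1(a,b)$ is neutral if every horn $u:\Lambda^2_0$ with $u_{01}\equiv e$ and every horn $u:\Lambda^2_2$ with $u_{12}\equiv e$ has contractible filling; this proposition is written $\mathsf{isNeutral}(e)$. $A$ is complete if $\Pi(x:A_0),\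 \mathsf{isContr}\big(\Sigma(y:A_0),(e:A_1(y,x)),\mathsf{isNeutral}(e)\big)$. A 2-degeneracy structure is a function $s^0_0:\Pi(x_0:A_0),A_1(x_0,x_0)$ together with functions $s^1_0,s^1_1$ assigning to each $x_0,x_1:A_0$, $x_{01}:A_1(x_0,x_1)$ an element of $A_2(u)$ for the boundaries $u$: for $s^1_0$: $u_0=u_1=x_0$, $u_2=x_1$, $u_{01}=s^0_0(x_0)$, $u_{02}=u_{12}=x_{01}$; for $s^1_1$: $u_0=x_0$, $u_1=u_2=x_1$, $u_{01}=u_{02}=x_{01}$, $u_{12}=s^0_0(x_1)$. *)

(* Defs.v *)
(** Identity types are Rocq's [=], Sigma-types are [sigT], and [U] is one fixed
    universe.  No axiom is assumed: neither univalence, nor function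
    extensionality, nor uniqueness of identity proofs.  Iterated Sigma-types are
    written as records, so that a component [x_S] is named by the subset [S]. *)

Definition U := Type.

Definition isContr (X : U) : U := {c : X & forall x : X, c = x}.

Record bd1 (A0 : U) : U := Bd1 {
  bd1_x0 : A0;
  bd1_x1 : A0 }.
Arguments Bd1 {A0} _ _.

Record bd2 (A0 : U) (A1 : bd1 A0 -> U) : U := Bd2 {
  bd2_x0 : A0;
  bd2_x1 : A0;
  bd2_x2 : A0;
  bd2_x01 : A1 (Bd1 bd2_x0 bd2_x1);
  bd2_x02 : A1 (Bd1 bd2_x0 bd2_x2);
  bd2_x12 : A1 (Bd1 bd2_x1 bd2_x2) }.
Arguments bd2 {A0} A1.
Arguments Bd2 {A0 A1} _ _ _ _ _ _.

Record bd3 (A0 : U) (A1 : bd1 A0 -> U) (A2 : bd2 A1 -> U) : U := Bd3 {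
  bd3_x0 : A0;
  bd3_x1 : A0;
  bd3_x2 : A0;
  bd3_x3 : A0;
  bd3_x01 : A1 (Bd1 bd3_x0 bd3_x1);
  bd3_x02 : A1 (Bd1 bd3_x0 bd3_x2);
  bd3_x03 : A1 (Bd1 bd3_x0 bd3_x3);
  bd3_x12 : A1 (Bd1 bd3_x1 bd3_x2);
  bd3_x13 : A1 (Bd1 bd3_x1 bd3_x3);
  bd3_x23 : A1 (Bd1 bd3_x2 bd3_x3);
  bd3_x012 : A2 (Bd2 bd3_x0 bd3_x1 bd3_x2 bd3_x01 bd3_x02 bd3_x12);
  bd3_x013 : A2 (Bd2 bd3_x0 bd3_x1 bd3_x3 bd3_x01 bd3_x03 bd3_x13);
  bd3_x023 : A2 (Bd2 bd3_x0 bd3_x2 bd3_x3 bd3_x02 bd3_x03 bd3_x23);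
  bd3_x123 : A2 (Bd2 bd3_x1 bd3_x2 bd3_x3 bd3_x12 bd3_x13 bd3_x23) }.
Arguments bd3 {A0 A1} A2.
Arguments Bd3 {A0 A1 A2} _ _ _ _ _ _ _ _ _ _ _ _ _ _.

(** 3-restricted semisimplicial types. *)
Record sst3 : Type := Sst3 {
  cell0 : U;
  cell1 : bd1 cell0 -> U;
  cell2 : bd2 cell1 -> U;
  cell3 : bd3 cell2 -> U }.
Arguments cell1 {s} _.
Arguments cell2 {s} _.
Arguments cell3 {s} _.

(** [hornKM] is the (K, M)-horn: the face opposite to vertex M is omitted. *)

Record horn20 (A : sst3) : U := Horn20 {
  h20_x0 : cell0 A;
  h20_x1 : cell0 A;
  h20_x2 : cell0 A;
  h20_x01 : cell1 (Bd1 h20_x0 h20_x1);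
  h20_x02 : cell1 (Bd1 h20_x0 h20_x2) }.
Arguments Horn20 {A} _ _ _ _ _.

Record horn21 (A : sst3) : U := Horn21 {
  h21_x0 : cell0 A;
  h21_x1 : cell0 A;
  h21_x2 : cell0 A;
  h21_x01 : cell1 (Bd1 h21_x0 h21_x1);
  h21_x12 : cell1 (Bd1 h21_x1 h21_x2) }.
Arguments Horn21 {A} _ _ _ _ _.

Record horn22 (A : sst3) : U := Horn22 {
  h22_x0 : cell0 A;
  h22_x1 : cell0 A;
  h22_x2 : cell0 A;
  h22_x02 : cell1 (Bd1 h22_x0 h22_x2);
  h22_x12 : cell1 (Bd1 h22_x1 h22_x2) }.
Arguments Horn22 {A} _ _ _ _ _.

Record horn31 (A : sst3) : U := Horn31 {
  h31_x0 : cell0 A;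
  h31_x1 : cell0 A;
  h31_x2 : cell0 A;
  h31_x3 : cell0 A;
  h31_x01 : cell1 (Bd1 h31_x0 h31_x1);
  h31_x02 : cell1 (Bd1 h31_x0 h31_x2);
  h31_x03 : cell1 (Bd1 h31_x0 h31_x3);
  h31_x12 : cell1 (Bd1 h31_x1 h31_x2);
  h31_x13 : cell1 (Bd1 h31_x1 h31_x3);
  h31_x23 : cell1 (Bd1 h31_x2 h31_x3);
  h31_x012 : cell2 (Bd2 h31_x0 h31_x1 h31_x2 h31_x01 h31_x02 h31_x12);
  h31_x013 : cell2 (Bd2 h31_x0 h31_x1 h31_x3 h31_x01 h31_x03 h31_x13);
  h31_x123 : cell2 (Bd2 h31_x1 h31_x2 h31_x3 h31_x12 h31_x13 h31_x23) }.
Arguments Horn31 {A} _ _ _ _ _ _ _ _ _ _ _ _ _.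

Definition filler20 {A : sst3} (u : horn20 A) : U :=
  let (x0, x1, x2, x01, x02) := u in
  {x12 : cell1 (Bd1 x1 x2) & cell2 (Bd2 x0 x1 x2 x01 x02 x12)}.

Definition filler21 {A : sst3} (u : horn21 A) : U :=
  let (x0, x1, x2, x01, x12) := u in
  {x02 : cell1 (Bd1 x0 x2) & cell2 (Bd2 x0 x1 x2 x01 x02 x12)}.

Definition filler22 {A : sst3} (u : horn22 A) : U :=
  let (x0, x1, x2, x02, x12) := u in
  {x01 : cell1 (Bd1 x0 x1) & cell2 (Bd2 x0 x1 x2 x01 x02 x12)}.

Definition filler31 {A : sst3} (u : horn31 A) : U :=
  let (x0, x1, x2, x3, x01, x02, x03, x12, x13, x23, x012, x013, x123) := u in
  {x023 : cell2 (Bd2 x0 x2 x3 x02 x03 x23) &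
   cell3 (Bd3 x0 x1 x2 x3 x01 x02 x03 x12 x13 x23 x012 x013 x023 x123)}.

Definition isSemiSegal (A : sst3) : U :=
  ((forall u : horn21 A, isContr (filler21 u)) *
   (forall u : horn31 A, isContr (filler31 u)))%type.

(** The horns having [e] as a prescribed component definitionally are
    parametrised by their remaining components. *)
Definition isNeutral {A : sst3} {a b : cell0 A} (e : cell1 (Bd1 a b)) : U :=
  ((forall (x2 : cell0 A) (x02 : cell1 (Bd1 a x2)),
      isContr (filler20 (Horn20 a b x2 e x02))) *
   (forall (x0 : cell0 A) (x02 : cell1 (Bd1 x0 b)),
      isContr (filler22 (Horn22 x0 a b x02 e))))%type.

Definition isComplete (A : sst3) : U :=
  forall x : cell0 A,
    isContr {y : cell0 A & {e : cell1 (Bd1 y x) & isNeutral e}}.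

Record degeneracy2 (A : sst3) : U := Degeneracy2 {
  s00 : forall x0 : cell0 A, cell1 (Bd1 x0 x0);
  s10 : forall (x0 x1 : cell0 A) (x01 : cell1 (Bd1 x0 x1)),
    cell2 (Bd2 x0 x0 x1 (s00 x0) x01 x01);
  s11 : forall (x0 x1 : cell0 A) (x01 : cell1 (Bd1 x0 x1)),
    cell2 (Bd2 x0 x1 x1 x01 x01 (s00 x1)) }.

(* Main.v *)
Require Import Defs.

(** Completeness provides, for every [x], a neutral edge [e : y -> x].
    Neutrality of [e] yields an endomorphism [i] of [x] together with a
    2-cell witnessing [e ; i = e]; this [i] is the degenerate edge.  It is a
    two-sided unit for the usual reason:
    - on the left, [e ; (i ; f) = (e ; i) ; f = e ; f], and [e] can be
      cancelled ([left_unit]);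
    - on the right, every [g : w -> x] factors as [g = h ; e], so that
      [g ; i = h ; (e ; i) = h ; e = g] ([right_unit]).
    Associativity is the filling of 3-dimensional inner horns. *)

(** Associativity: reading a 2-cell as [its middle edge is the composite of the
    outer two], [x02 ; x23 = x01 ; (x12 ; x23)]. *)
Lemma associate {A : sst3} (hS : isSemiSegal A) {x0 x1 x2 x3 : cell0 A}
  {x01 : cell1 (Bd1 x0 x1)} {x02 : cell1 (Bd1 x0 x2)}
  {x03 : cell1 (Bd1 x0 x3)} {x12 : cell1 (Bd1 x1 x2)}
  {x13 : cell1 (Bd1 x1 x3)} {x23 : cell1 (Bd1 x2 x3)}
  (x012 : cell2 (Bd2 x0 x1 x2 x01 x02 x12))
  (x013 : cell2 (Bd2 x0 x1 x3 x01 x03 x13))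
  (x123 : cell2 (Bd2 x1 x2 x3 x12 x13 x23)) :
  cell2 (Bd2 x0 x2 x3 x02 x03 x23).
Proof.
  exact (projT1 (projT1 (snd hS
    (Horn31 x0 x1 x2 x3 x01 x02 x03 x12 x13 x23 x012 x013 x123)))).
Defined.

(** Neutral edges are epimorphisms: two edges with the same composite after
    [e] both occur in fillers of the same outer horn. *)
Lemma neutral_cancel {A : sst3} {y x z : cell0 A} {e : cell1 (Bd1 y x)}
  (ne : isNeutral e) {k : cell1 (Bd1 y z)} {f g : cell1 (Bd1 x z)}
  (tf : cell2 (Bd2 y x z e k f)) (tg : cell2 (Bd2 y x z e k g)) : f = g.
Proof.
  destruct (fst ne z k) as [c Hc].
  exact (f_equal (@projT1 _ _)
    (eq_trans (eq_sym (Hc (existT _ f tf))) (Hc (existT _ g tg)))).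
Defined.

(** A composite [c] of [i] and [f] satisfies [e ; c = (e ; i) ; f = e ; f],
    so cancelling [e] identifies [c] with [f]. *)
Lemma left_unit {A : sst3} (hS : isSemiSegal A) {y x z : cell0 A}
  {e : cell1 (Bd1 y x)} (ne : isNeutral e) {i : cell1 (Bd1 x x)}
  (ei : cell2 (Bd2 y x x e e i)) (f : cell1 (Bd1 x z)) :
  cell2 (Bd2 x x z i f f).
Proof.
  destruct (projT1 (fst hS (Horn21 x x z i f))) as [c i_f].
  destruct (projT1 (fst hS (Horn21 y x z e c))) as [k e_c].
  destruct (neutral_cancel ne e_c (associate hS ei e_c i_f)).
  exact i_f.
Defined.

(** In the tetrahedron on the path [h], [e], [i], the faces 012 and 013 can be
    the same 2-cell [h ; e = g], because [e ; i = e]. *)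
Lemma right_unit {A : sst3} (hS : isSemiSegal A) {w y x : cell0 A}
  {e : cell1 (Bd1 y x)} (ne : isNeutral e) {i : cell1 (Bd1 x x)}
  (ei : cell2 (Bd2 y x x e e i)) (g : cell1 (Bd1 w x)) :
  cell2 (Bd2 w x x g g i).
Proof.
  destruct (projT1 (snd ne w g)) as [h h_e].
  exact (associate hS h_e h_e ei).
Defined.

(** The neutral edge and the loop are bundled because the unit laws at [x] must
    be proved for the loop obtained from that very edge. *)
Record unit_data {A : sst3} (x : cell0 A) : U := UnitData {
  source : cell0 A;
  edge : cell1 (Bd1 source x);
  edge_neutral : isNeutral edge;
  loop : cell1 (Bd1 x x);
  edge_loop : cell2 (Bd2 source x x edge edge loop) }.
Arguments UnitData {A x} _ _ _ _ _.
Arguments edge_neutral {A x} _.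
Arguments loop {A x} _.
Arguments edge_loop {A x} _.

Lemma complete_unit_data {A : sst3} (hC : isComplete A) (x : cell0 A) :
  unit_data x.
Proof.
  destruct (projT1 (hC x)) as [y [e ne]].
  (* [e] is divided by itself, using that it is neutral. *)
  destruct (projT1 (fst ne x e)) as [i ei].
  exact (UnitData y e ne i ei).
Defined.

Theorem lemma5p8 (A : sst3) (hS : isSemiSegal A) (hC : isComplete A) :
  degeneracy2 A.
Proof.
  pose (d := complete_unit_data hC).
  exact (Degeneracy2 A (fun x => loop (d x))
    (fun x0 x1 => left_unit hS (edge_neutral (d x0)) (edge_loop (d x0)))
    (fun x0 x1 => right_unit hS (edge_neutral (d x1)) (edge_loop (d x1)))).
Qed.
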